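(* Let $K\in\mathcal{T}$ be a control volume and let $\sigma$ be a face of $K$ which is either an interior face $\sigma=K|L$ or a Dirichlet boundary face. Let $U_K>0$ and $U_\sigma>0$ (where $U_\sigma=U_L$ if $\sigma=K|L$), let $dr_{K,\sigma}=dr(U_K,U_\sigma)$, and let $$\mathcal{F}_{K,\sigma}=\tau_\sigma\, dr_{K,\sigma}\Big(B\Big(\frac{-d_\sigma q_{K,\sigma}}{dr_{K,\sigma}}\Big)U_K-B\Big(\frac{d_\sigma q_{K,\sigma}}{dr_{K,\sigma}}\Big)U_\sigma\Big).$$ If $d_\sigma q_{K,\sigma}=h(U_\sigma)-h(U_K)$, then $\mathcal{F}_{K,\sigma}=0$.
   Context: $r\in C^2(\mathbb{R})$ is strictly increasing on $(0,\infty)$, $r(0)=r'(0)=0$, and there are constants $c_0>0$, $\gamma\ge 1$ with $r'(s)\ge c_0s^{\gamma-1}$ for all $s>0$. The enthalpy is $h(s)=\int_1^s\frac{r'(\tau)}{\tau}\,d\tau$ for $s>0$. The Bernoulli function is $B(x)=\frac{x}{e^x-1}$ for $x\ne0$, $B(0)=1$. For $a,b\ge0$: $dr(a,b)=\frac{h(b)-h(a)}{\log b-\log a}$ if $ab>0$ and $a\neq b$, and $dr(a,b)=r'\big(\frac{a+b}{2}\big)$ otherwise. In a finite volume mesh with control volumes $K$ and cell centers $x_K$: $d_\sigma>0$ is the distance between $x_K$ and $x_L$ if $\sigma=K|L$ is the common face of $K$ and $L$, or the distance from $x_K$ to $\sigma$ if $\sigma$ is a boundary face; $\tau_\sigma=\mathrm{m}(\sigma)/d_\sigma>0$,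 where $\mathrm m(\sigma)$ is the measure of $\sigma$; $q_{K,\sigma}\in\mathbb{R}$ is the mean over $\sigma$ of the outward normal component $\mathbf{q}\cdot\mathbf{n}_{K,\sigma}$ of the convection field $\mathbf{q}$. For this statement only the facts that $d_\sigma,\tau_\sigma>0$ and $q_{K,\sigma}\in\mathbb{R}$ matter. $\mathcal{F}_{K,\sigma}$ is a numerical approximation of $-\int_\sigma(\nabla r(u)-\mathbf{q}u)\cdot\mathbf{n}_{K,\sigma}$. *)

(* Defs.v *)
From Stdlib Require Import Reals.
From Coquelicot Require Import Coquelicot.
Open Scope R_scope.

(* [ex_derive_n f k x] alone does not imply [ex_derive_n f j x] for [j < k],
   because [Derive] is total; hence the quantification over all orders. *)
Definition C2 (f : R -> R) : Prop :=
  (forall (k : nat) (x : R), (k <= 2)%nat -> ex_derive_n f k x) /\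
  (forall x : R, continuous (Derive_n f 2) x).

(* [RInt] is oriented, so this is the intended value for [s < 1] as well. *)
Definition enthalpy (r : R -> R) (s : R) : R :=
  RInt (fun t => Derive r t / t) 1 s.

Definition Bernoulli (x : R) : R :=
  if Req_EM_T x 0 then 1 else x / (exp x - 1).

Definition dr (r : R -> R) (a b : R) : R :=
  if Rlt_dec 0 (a * b) then
    if Req_EM_T a b then Derive r ((a + b) / 2)
    else (enthalpy r b - enthalpy r a) / (ln b - ln a)
  else Derive r ((a + b) / 2).

(* Of the geometry, only the incidence relation between control volumes and
   faces, the measures m(sigma) and the distances d_sigma are retained. *)
Record mesh : Type := Mesh {
  cell : Type;
  face : Type;
  is_face : cell -> face -> Prop;
  is_dirichlet : face -> Prop;
  face_measure : face -> R;
  face_dist : face -> R;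
  face_neighbour_unique : forall (K L L' : cell) (s : face),
    is_face K s -> is_face L s -> is_face L' s ->
    K <> L -> K <> L' -> L = L';
  (* a Dirichlet face lies on the boundary of the domain *)
  dirichlet_boundary : forall (K L : cell) (s : face),
    is_dirichlet s -> is_face K s -> is_face L s -> K = L;
  face_measure_pos : forall s : face, 0 < face_measure s;
  face_dist_pos : forall s : face, 0 < face_dist s
}.

(* sigma = K|L *)
Definition common_face (M : mesh) (K L : cell M) (s : face M) : Prop :=
  K <> L /\ is_face M K s /\ is_face M L s.

Definition transmissibility (M : mesh) (s : face M) : R :=
  face_measure M s / face_dist M s.

(* [qKs], [UK], [Us] stand for q_{K,sigma}, U_K, U_sigma. *)
Definition numerical_flux (r : R -> R) (M : mesh) (s : face M)
    (qKs UK Us : R) : R :=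
  let drKs := dr r UK Us in
  transmissibility M s * drKs *
    (Bernoulli (- face_dist M s * qKs / drKs) * UK
     - Bernoulli (face_dist M s * qKs / drKs) * Us).

(* Main.v *)
Require Import Defs.
From Stdlib Require Import Reals Lra.
From Coquelicot Require Import Coquelicot.
Open Scope R_scope.

(* For unequal states the choice of dr turns the equilibrium condition into
   d q / dr = ln b - ln a, and the weights B(-x) and B(x) at x = ln b - ln a
   balance a against b, since B(x) / B(-x) = exp (- x) = a / b. If the enthalpies
   coincide, the quotient d q / dr is a junk value, but then dr = 0 and the flux
   vanishes through its prefactor. *)

Lemma Bernoulli_0 : Bernoulli 0 = 1.
Proof. unfold Bernoulli; destruct (Req_EM_T 0 0); lra. Qed.

Lemma Bernoulli_neq0 (x : R) : x <> 0 -> Bernoulli x = x / (exp x - 1).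
Proof. intros hx; unfold Bernoulli; destruct (Req_EM_T x 0); lra. Qed.

(** Multiplying numerator and denominator of [- x / (exp (- x) - 1)] by [exp x] gives it; at [x = 0]
    both sides are 1. *)
Lemma Bernoulli_opp (x : R) : Bernoulli (- x) = exp x * Bernoulli x.
Proof.
destruct (Req_dec x 0) as [-> | hx].
  now rewrite Ropp_0, Bernoulli_0, exp_0, Rmult_1_l.
assert (he : exp x <> 1) by (rewrite <- exp_0; intros e; apply hx, exp_inv, e).
rewrite !Bernoulli_neq0, exp_Ropp by lra.
pose proof (exp_pos x).
field; repeat split; lra.
Qed.

Lemma Bernoulli_balance (a b : R) : 0 < a -> 0 < b ->
  Bernoulli (- (ln b - ln a)) * a = Bernoulli (ln b - ln a) * b.
Proof.
intros ha hb.
(* Only the exponent is opened, to become [b / a]; the argument of [Bernoulli] stays intact as an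
   atom for [field]. *)
rewrite Bernoulli_opp; unfold Rminus at 1.
rewrite exp_plus, exp_Ropp, !exp_ln by assumption.
field; lra.
Qed.

Lemma ln_neq (a b : R) : 0 < a -> 0 < b -> a <> b -> ln b - ln a <> 0.
Proof.
intros ha hb hab e.
apply hab, ln_inv; [assumption | assumption | lra].
Qed.

Lemma dr_neq (r : R -> R) (a b : R) : 0 < a -> 0 < b -> a <> b ->
  dr r a b = (enthalpy r b - enthalpy r a) / (ln b - ln a).
Proof.
intros ha hb hab; unfold dr.
pose proof (Rmult_lt_0_compat a b ha hb).
destruct (Rlt_dec 0 (a * b)); [| lra].
now destruct (Req_EM_T a b).
Qed.

(** Treats interior and Dirichlet faces at once: [b] is the neighbouring or the boundary state. *)
Lemma numerical_flux_equilibrium (r : R -> R) (M : mesh) (s : face M)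
    (q a b : R) : 0 < a -> 0 < b ->
  face_dist M s * q = enthalpy r b - enthalpy r a ->
  numerical_flux r M s q a b = 0.
Proof.
intros ha hb heq; unfold numerical_flux; cbv zeta.
(* The minus sign binds to [face_dist M s] alone; pulling it out lets [heq] rewrite both
   arguments. *)
rewrite Ropp_mult_distr_l_reverse, heq.
destruct (Req_dec a b) as [<- | hab].
  (* Both arguments are [0 * / dr r a a], which is 0 whatever the value of [dr], so both weights are
     1. *)
  unfold Rdiv; rewrite Rminus_diag, Ropp_0, Rmult_0_l, Bernoulli_0; ring.
pose proof (ln_neq a b ha hb hab) as hln.
rewrite dr_neq by assumption.
destruct (Req_dec (enthalpy r b - enthalpy r a) 0) as [e | hh].
  rewrite e; unfold Rdiv; ring.
set (h := enthalpy r b - enthalpy r a) in *.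
replace (- h / (h / (ln b - ln a))) with (- (ln b - ln a))
  by (field; split; assumption).
replace (h / (h / (ln b - ln a))) with (ln b - ln a)
  by (field; split; assumption).
rewrite Bernoulli_balance by assumption; ring.
Qed.

Theorem mainTheorem2
  (r : R -> R) (c0 gamma : R)
  (r_C2 : C2 r)
  (r_incr : forall x y : R, 0 < x -> x < y -> r x < r y)
  (r_0 : r 0 = 0)
  (r'_0 : Derive r 0 = 0)
  (c0_pos : 0 < c0)
  (gamma_ge1 : 1 <= gamma)
  (r'_lower : forall s : R, 0 < s -> c0 * Rpower s (gamma - 1) <= Derive r s)
  (M : mesh) (q : cell M -> face M -> R)
  (U : cell M -> R)
  (K : cell M) (sigma : face M)
  (K_sigma : is_face M K sigma)
  (sigma_type : (exists L : cell M, common_face M K L sigma)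
                \/ is_dirichlet M sigma)
  (Usigma : R)
  (Usigma_interior : forall L : cell M,
     common_face M K L sigma -> Usigma = U L)
  (UK_pos : 0 < U K)
  (Usigma_pos : 0 < Usigma)
  (equilibrium : face_dist M sigma * q K sigma
                 = enthalpy r Usigma - enthalpy r (U K)) :
  numerical_flux r M sigma (q K sigma) (U K) Usigma = 0.
Proof.
now apply numerical_flux_equilibrium.
Qed.
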